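(* Let $f$ be a self-concordant barrier with domain $D_f\subset\mathbb{R}^n$ and Hessian $H$, and suppose that $D_f\subset\mathbb{R}_{>0}^n$. Then for all $x\in D_f$, $$H(x)\succcurlyeq\frac1n\operatorname{Diag}\Big(\frac{1}{x^2}\Big).$$
   Context: $f$ is a $C^2$ real-valued function on an open convex set $D_f \subset \mathbb{R}^n$, with gradient $g(x)$ and positive definite Hessian $H(x)$. Put $\|v\|_x := \sqrt{v^\top H(x) v}$ and $B_x(y,r) := \{z\in\mathbb{R}^n : \|y-z\|_x < r\}$. $f$ is (strongly nondegenerate) self-concordant if for all $x \in D_f$ we have $B_x(x,1) \subset D_f$ and, for all $y \in B_x(x,1)$ and $v \neq 0$, $1-\|y-x\|_x \leq \|v\|_y/\|v\|_x \leq 1/(1-\|y-x\|_x)$. It is a $\vartheta$-self-concordant barrier if moreover $\vartheta := \sup_{x \in D_f} \|H(x)^{-1}g(x)\|_x^2 < \infty$. $\operatorname{Diag}(1/x^2)$ is the diagonal matrix with diagonal entries $1/x_i^2$, and $A\succcurlyeq B$ means $z^\top Az\geq z^\top Bz$ for all $z\in\mathbb{R}^n$. *)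

(* Defs.v *)
From HB Require Import structures.
From mathcomp Require Import all_boot all_order all_algebra.
From mathcomp Require Import all_classical all_reals all_analysis.

Set Implicit Arguments.
Unset Strict Implicit.
Unset Printing Implicit Defensive.

Import Order.TTheory GRing.Theory Num.Theory.
Import numFieldNormedType.Exports.

Local Open Scope classical_set_scope.
Local Open Scope ring_scope.

(* A real-valued function with domain D is represented by a total function f
   together with the set D: only the values of f on D are constrained, and as
   D is always open, the partial derivatives of f at points of D depend only
   on these values. *)

Section Calculus.
Context {R : realType} {n : nat}.
Implicit Types (f : 'cV[R]_n -> R) (D : set 'cV[R]_n) (x : 'cV[R]_n).

Definition partial (i : 'I_n) f : 'cV[R]_n -> R :=
  fun x => 'D_(delta_mx i 0 : 'cV[R]_n) f x.

Definition gradient f x : 'cV[R]_n := \col_i partial i f x.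

Definition hessian f x : 'M[R]_n :=
  \matrix_(i, j) partial i (partial j f) x.

(* All partial derivatives of order at most 2 exist and are continuous on D
   ('D_v f x has an unspecified value where f is not derivable, hence the
   explicit derivability conditions). For D open, continuity at each point of
   D is continuity on D. *)
Definition C2_on D f : Prop :=
  forall x, D x ->
    [/\ {for x, continuous f},
        forall i : 'I_n, derivable f x (delta_mx i 0 : 'cV[R]_n)
               /\ {for x, continuous (partial i f)} &
        forall i j : 'I_n, derivable (partial j f) x (delta_mx i 0 : 'cV[R]_n)
                 /\ {for x, continuous (partial i (partial j f))}].

End Calculus.

Section QuadraticForms.
Context {R : realType} {n : nat}.
Implicit Types (A B : 'M[R]_n) (v z : 'cV[R]_n).

Definition qform A v : R := (v^T *m A *m v) 0 0.

(* Symmetry is not part of this condition: it is automatic for the Hessian of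
   a C^2 function. *)
Definition posdefmx A : Prop := forall v, v != 0 -> 0 < qform A v.

Definition loewner_ge A B : Prop := forall z, qform B z <= qform A z.

End QuadraticForms.

Section SelfConcordance.
Context {R : realType} {n : nat}.
Implicit Types (f : 'cV[R]_n -> R) (D : set 'cV[R]_n) (x y v : 'cV[R]_n).

Definition lnorm f x v : R := Num.sqrt (qform (hessian f x) v).

Definition lball f x y (r : R) : set 'cV[R]_n :=
  [set z : 'cV[R]_n | lnorm f x (y - z) < r].

Definition self_concordant D f : Prop :=
  [/\ open D, convex_set D, C2_on D f,
      forall x, D x -> posdefmx (hessian f x) &
      forall x, D x ->
        lball f x x 1 `<=` D /\
        forall y v, lball f x x 1 y -> v != 0 ->
          1 - lnorm f x (y - x) <= lnorm f y v / lnorm f x v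
            <= 1 / (1 - lnorm f x (y - x))].

(* The supremum is taken in the extended reals. *)
Definition barrier_parameter D f : \bar R :=
  ereal_sup [set ((lnorm f x (invmx (hessian f x) *m gradient f x)) ^+ 2)%:E
            | x in D].

Definition self_concordant_barrier D f : Prop :=
  self_concordant D f /\ (barrier_parameter D f < +oo)%E.

End SelfConcordance.

(* Main.v *)
(* The Dikin ellipsoid at x lies in D, hence in the open positive orthant. If
   |v_i| / x_i exceeded the local norm of v, then x - (x_i / v_i) v would be a
   point of this ellipsoid with vanishing i-th coordinate. So
   (v_i / x_i)^2 <= v^T H(x) v for every i; averaging over i gives the claim. *)

Require Import Defs.
From HB Require Import structures.
From mathcomp Require Import all_boot all_order all_algebra.
From mathcomp Require Import all_classical all_reals all_analysis.
Import Order.TTheory GRing.Theory Num.Theory.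
Import numFieldNormedType.Exports.
Local Open Scope classical_set_scope.
Local Open Scope ring_scope.

Lemma qformZ (R : realType) (n : nat) (A : 'M[R]_n) (a : R) (v : 'cV[R]_n) :
  qform A (a *: v) = a ^+ 2 * qform A v.
Proof.
by rewrite /qform -scalemxAr [(a *: v)^T]linearZ /= -!scalemxAl !mxE mulrA -expr2.
Qed.

Lemma qform_scale_diag (R : realType) (n : nat) (c : R) (d : 'rV[R]_n)
    (v : 'cV[R]_n) :
  qform (c *: diag_mx d) v = c * \sum_i d 0 i * v i 0 ^+ 2.
Proof.
rewrite /qform -scalemxAr -scalemxAl mxE; congr (_ * _).
rewrite mxE; apply: eq_bigr => i _.
by rewrite mul_mx_diag !mxE expr2 mulrA [d 0 i * _]mulrC.
Qed.

Lemma posdefmx_qform_ge0 (R : realType) (n : nat) (A : 'M[R]_n) (v : 'cV[R]_n) :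
  posdefmx A -> 0 <= qform A v.
Proof.
move=> Apos; have [->|/Apos/ltW //] := eqVneq v 0.
by rewrite /qform mulmx0 mxE.
Qed.

Lemma coord_sqr_le_qform (R : realType) (n : nat) (D : set 'cV[R]_n)
    (f : 'cV[R]_n -> R) (x v : 'cV[R]_n) (i : 'I_n) :
  posdefmx (hessian f x) -> lball f x x 1 `<=` D ->
  (forall y, D y -> 0 < y i 0) -> 0 < x i 0 ->
  (v i 0 / x i 0) ^+ 2 <= qform (hessian f x) v.
Proof.
move=> Hpos ballD Dpos xi0.
(* The point constructed below divides by [v i 0], so a vanishing coordinate is treated apart; the
   left side is then 0. *)
have [vi0|vi0] := eqVneq (v i 0) 0.
  by rewrite vi0 mul0r expr0n; apply: posdefmx_qform_ge0.
rewrite leNgt; apply/negP => qlt.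
have : D (x - (x i 0 / v i 0) *: v).
  apply: ballD; rewrite /lball /= /lnorm opprB addrC subrK qformZ.
  (* The displacement from [x] has squared local norm [(x i 0 / v i 0) ^+ 2] times
     [qform (hessian f x) v]. Dividing by this positive square turns the bound by 1 into [qlt]. *)
  rewrite -sqrtr1 ltr_sqrt ?ltr01 // mulrC -ltr_pdivlMr.
    by rewrite mul1r -exprVn invf_div.
  by rewrite exprn_even_gt0 //= mulf_neq0 ?invr_eq0 // gt_eqF.
by move/Dpos; rewrite !mxE divfK // subrr ltxx.
Qed.

Theorem proposition4 (R : realType) (n : nat) (D : set 'cV[R]_n)
    (f : 'cV[R]_n -> R)
    (hf : self_concordant_barrier D f)
    (hD : D `<=` [set x : 'cV[R]_n | forall i : 'I_n, 0 < x i 0]) :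
  forall x : 'cV[R]_n, D x ->
    loewner_ge (hessian f x)
      ((1 / n%:R) *: diag_mx (\row_(i < n) (1 / x i 0 ^+ 2))).
Proof.
case: hf => -[_ _ _ Hpos Hball] _ x Dx v.
rewrite qform_scale_diag.
(* For [n = 0] the factor [1 / n%:R] is 0 by the convention on inverses, so only nonnegativity of
   the Hessian form is left. *)
have [n0|n_gt0] := posnP n.
  have -> : n%:R = 0 :> R by rewrite n0.
  by rewrite invr0 mulr0 mul0r; apply: posdefmx_qform_ge0; apply: Hpos.
(* After multiplication by [n], the Hessian side is a sum of [n] equal terms indexed by ['I_n],
   which allows a termwise comparison. *)
rewrite mul1r mulrC ler_pdivrMr ?ltr0n // -[n in n%:R]card_ord mulr_natr.
rewrite -sumr_const; apply: ler_sum => i _.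
have -> : (\row_(j < n) (1 / x j 0 ^+ 2)) 0 i * v i 0 ^+ 2 = (v i 0 / x i 0) ^+ 2.
  by rewrite mxE mul1r expr_div_n mulrC.
apply: (@coord_sqr_le_qform _ _ D); [exact: Hpos|by case: (Hball x Dx)| |exact: hD].
by move=> y Dy; apply: hD.
Qed.
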